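(* The linking matrix is a homotopy invariant of a Gauss phrase; that is, if $p$ and $q$ are homotopic $n$-component Gauss phrases, then the linking matrix of $p$ equals the linking matrix of $q$.
   Context: A word on an alphabet (finite set) $\mathcal{A}$ is a finite, possibly empty, sequence of letters of $\mathcal{A}$. A Gauss word on $\mathcal{A}$ is a word on $\mathcal{A}$ in which every letter of $\mathcal{A}$ appears exactly twice. A Gauss phrase on $\mathcal{A}$ is a finite sequence of words $x_1,\dots,x_m$ on $\mathcal{A}$ (written $x_1|\cdots|x_m$) whose concatenation $x_1x_2\cdots x_m$ is a Gauss word on $\mathcal{A}$; the $x_i$ are its components. Different Gauss phrases may have different alphabets. Isomorphism: Gauss phrases $p_1$ on $\mathcal{A}_1$ and $p_2$ on $\mathcal{A}_2$ are isomorphic if there is a bijection $\mathcal{A}_1\to\mathcal{A}_2$ which applied letterwise to $p_1$ gives $p_2$. Homotopy moves. Below $A,B,C$ are individual (distinct) letters, and $w,x,y,z$ are arbitrary (possibly empty) sequences of letters, possibly including the separator $|$; each move starts and ends with a Gauss phrase. H1: $xAAy \to xy$. H2: $xAByBAz \to xyz$. H3: $wABxACyBCz \to wBAxCAyCBz$. (In each move each displayed two-letter subword lies in a single component; different subwords may lie in the same or different components. The inverses of H1 and H2 insert letters not already appearing in the phrase.) Shift move: if the $k$th component is $Ay$ with $A$ a letter, replace it by $yA$, leaving the other components unchanged. Two Gauss phrases are homotopic if they are related by a finite sequence of isomorphisms, shift moves, and the moves H1, H2, H3 and their inverses. All these operations preserve the number and order of components. Linking matrix: for an $n$-component Gauss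 phrase, this is the symmetric $n\times n$ matrix $(l_{ij})$ over $\mathbb{Z}/2\mathbb{Z}$ with $l_{ii}=0$ for all $i$ and, for $i\neq j$, $l_{ij}$ equal to the number, modulo $2$, of letters that appear once in the $i$th component and once in the $j$th component. *)

(* Defs.v *)
From HB Require Import structures.
From mathcomp Require Import all_boot all_order all_algebra.

Set Implicit Arguments.
Unset Strict Implicit.
Unset Printing Implicit Defensive.

Import GRing.Theory.

Record gauss_phrase (n : nat) (A : finType) := GaussPhrase {
  components :> n.-tuple (seq A);
  _ : forall a : A, count_mem a (flatten components) = 2
}.

(* The phrase x_1|...|x_n written out as one sequence of symbols: [Some a] is
   the letter [a] and [None] is the separator [|].  For a fixed number [n] of
   components this determines the phrase, and two adjacent [Some] symbols lie
   in the same component. *)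
Definition display (n : nat) (A : finType) (p : gauss_phrase n A) :
    seq (option A) :=
  if val (components p) is x :: s then
    map Some x ++ flatten [seq None :: map Some y | y <- s]
  else [::].

Definition isomorphism (n : nat) (A1 A2 : finType)
    (p : gauss_phrase n A1) (q : gauss_phrase n A2) : Prop :=
  exists2 f : A1 -> A2, bijective f &
    forall i : 'I_n, tnth q i = map f (tnth p i).

Definition shift_move (n : nat) (A : finType) (p q : gauss_phrase n A) : Prop :=
  exists (k : 'I_n) (a : A) (y : seq A),
    tnth p k = a :: y /\
    forall i : 'I_n, tnth q i = if i == k then rcons y a else tnth p i.

(* [H1] and [H2] remove letters from the alphabet, so the resulting phrase is
   on the corresponding subtype and is compared with the original one through
   the inclusion [val]. *)
Definition without1 (A : finType) (a : A) : finType := {c : A | c != a}.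

Definition without2 (A : finType) (a b : A) : finType :=
  {c : A | (c != a) && (c != b)}.

Definition H1_move (n : nat) (A : finType) (a : A)
    (p : gauss_phrase n A) (q : gauss_phrase n (without1 a)) : Prop :=
  exists x y : seq (option A),
    display p = x ++ [:: Some a; Some a] ++ y /\
    map (omap val) (display q) = x ++ y.

Definition H2_move (n : nat) (A : finType) (a b : A)
    (p : gauss_phrase n A) (q : gauss_phrase n (without2 a b)) : Prop :=
  a != b /\
  exists x y z : seq (option A),
    display p = x ++ [:: Some a; Some b] ++ y ++ [:: Some b; Some a] ++ z /\
    map (omap val) (display q) = x ++ y ++ z.

Definition H3_move (n : nat) (A : finType) (p q : gauss_phrase n A) : Prop :=
  exists a b c : A,
    uniq [:: a; b; c] /\
    exists w x y z : seq (option A),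
      display p = w ++ [:: Some a; Some b] ++ x ++ [:: Some a; Some c]
                    ++ y ++ [:: Some b; Some c] ++ z /\
      display q = w ++ [:: Some b; Some a] ++ x ++ [:: Some c; Some a]
                    ++ y ++ [:: Some c; Some b] ++ z.

Inductive move (n : nat) : forall A1 A2 : finType,
    gauss_phrase n A1 -> gauss_phrase n A2 -> Prop :=
| move_iso (A1 A2 : finType)
    (p : gauss_phrase n A1) (q : gauss_phrase n A2) :
    isomorphism p q -> move p q
| move_shift (A : finType) (p q : gauss_phrase n A) :
    shift_move p q -> move p q
| move_H1 (A : finType) (a : A)
    (p : gauss_phrase n A) (q : gauss_phrase n (without1 a)) :
    H1_move p q -> move p q
| move_H2 (A : finType) (a b : A)
    (p : gauss_phrase n A) (q : gauss_phrase n (without2 a b)) :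
    H2_move p q -> move p q
| move_H3 (A : finType) (p q : gauss_phrase n A) :
    H3_move p q -> move p q.

Inductive homotopic (n : nat) : forall A1 A2 : finType,
    gauss_phrase n A1 -> gauss_phrase n A2 -> Prop :=
| homotopic_refl (A : finType) (p : gauss_phrase n A) : homotopic p p
| homotopic_move (A1 A2 A3 : finType) (p : gauss_phrase n A1)
    (q : gauss_phrase n A2) (r : gauss_phrase n A3) :
    homotopic p q -> move q r -> homotopic p r
| homotopic_inv (A1 A2 A3 : finType) (p : gauss_phrase n A1)
    (q : gauss_phrase n A2) (r : gauss_phrase n A3) :
    homotopic p q -> move r q -> homotopic p r.

Definition linking_matrix (n : nat) (A : finType) (p : gauss_phrase n A) :
    'M['F_2]_n :=
  (\matrix_(i < n, j < n)
    if i == j then 0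
    else #|[set a : A | (count_mem a (tnth p i) == 1%N)
                     && (count_mem a (tnth p j) == 1%N)]|%:R)%R.

(* Main.v *)
(* Write c_i(a) for the number of occurrences of the letter a in component i.
   For i <> j, Gauss's condition forces c_i(a) + c_j(a) <= 2, so that
   c_i(a) c_j(a) is 1 when a occurs once in each of the two components and 0
   otherwise; hence l_ij is the sum over all a of c_i(a) c_j(a), modulo 2.
   Isomorphisms permute the terms of this sum, while shifts and H3 fix every
   c_i(a).  H1 removes a letter with a single nonzero c_i, which contributes
   nothing, and H2 removes two letters with equal c_i, whose contributions
   cancel modulo 2. *)
Require Import Defs.
From mathcomp Require Import all_boot all_order all_algebra.

Set Implicit Arguments.
Unset Strict Implicit.
Unset Printing Implicit Defensive.

Import GRing.Theory.

(* The letters of a displayed phrase, each paired with the index of its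
   component, the first component having index [m]. *)
Fixpoint indexed (T : Type) (m : nat) (s : seq (option T)) : seq (nat * T) :=
  match s with
  | [::] => [::]
  | Some a :: s' => (m, a) :: indexed m s'
  | None :: s' => indexed m.+1 s'
  end.

Definition separators (T : Type) (s : seq (option T)) : nat :=
  count (fun o => ~~ isSome o) s.

Lemma indexed_cat (T : Type) (m : nat) (s t : seq (option T)) :
  indexed m (s ++ t) = indexed m s ++ indexed (m + separators s) t.
Proof.
elim: s m => [|[a|] s IHs] m /=; first by rewrite addn0.
- by rewrite IHs.
- by rewrite IHs /= addSnnS.
Qed.

Lemma indexed_map_Some (T : Type) (m : nat) (x : seq T) :
  indexed m (map Some x) = map (pair m) x.
Proof. by elim: x => //= a x ->. Qed.

Lemma separators_map_Some (T : Type) (x : seq T) : separators (map Some x) = 0.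
Proof. by elim: x. Qed.

Lemma indexed_omap (T U : Type) (f : T -> U) (m : nat) (s : seq (option T)) :
  indexed m (map (omap f) s) = [seq (u.1, f u.2) | u <- indexed m s].
Proof. by elim: s m => [|[a|] s IHs] m //=; rewrite IHs. Qed.

Lemma count_indexed_lt (T : eqType) (k m : nat) (c : T) (s : seq (option T)) :
  k < m -> count_mem (k, c) (indexed m s) = 0.
Proof.
elim: s m => [|[a|] s IHs] m //= lt_km; last by rewrite IHs // ltnW.
by rewrite IHs // xpair_eqE gtn_eqF.
Qed.

Lemma count_map_pair (T : eqType) (k m : nat) (c : T) (x : seq T) :
  count_mem (k, c) (map (pair m) x) = (m == k) * count_mem c x.
Proof.
rewrite count_map; case: (eqVneq m k) => [->|ne_mk].
  by rewrite mul1n; apply: eq_count => d /=; rewrite xpair_eqE eqxx.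
rewrite mul0n -(count_pred0 x); apply: eq_count => d /=.
by rewrite xpair_eqE (negbTE ne_mk).
Qed.

(** The start index [m] is arbitrary because the induction on [s] restarts after a separator, at
    [m.+1]. *)
Lemma count_indexed_blocks (T : eqType) (m k : nat) (c : T) (x : seq T)
    (s : seq (seq T)) :
  count_mem (m + k, c)
    (indexed m (map Some x ++ flatten [seq None :: map Some y | y <- s]))
  = count_mem c (nth [::] (x :: s) k).
Proof.
elim: s m k x => [|y s IHs] m k x; rewrite indexed_cat count_cat
  indexed_map_Some separators_map_Some addn0 count_map_pair -{1}[m]addn0 eqn_add2l.
  by case: k => [|k] /=; rewrite ?nth_nil ?mul1n addn0.
case: k => [|k] /=; last by rewrite -addSnnS IHs.
by rewrite mul1n count_indexed_lt ?addn0.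
Qed.

(** H1, H2 and H3 cut up the display, while linking numbers count within components; this passes
    from one to the other. *)
Lemma count_display (n : nat) (A : finType) (p : gauss_phrase n A) (i : 'I_n)
    (c : A) :
  count_mem c (tnth p i) = count_mem (val i, c) (indexed 0 (display p)).
Proof.
rewrite (tnth_nth [::]) /display.
case Dp: (val (components p)) => [|x s].
  (* Having no components means [n = 0], and then no index [i] exists. *)
  by have := size_tuple (components p); rewrite Dp; case: i => k /[swap] <-.
by rewrite [tval _]Dp -(count_indexed_blocks 0).
Qed.

(** The setting common to H1 and H2: [P] selects the surviving letters, and [s] is what remains of
    the larger display. *)
Section RemovedLetters.

Variables (n : nat) (A : finType) (P : pred A).
Variables (q : gauss_phrase n {c : A | P c}) (s : seq (option A)).
Hypothesis Ds : map (omap val) (display q) = s.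

Lemma count_kept (i : 'I_n) (c : {c : A | P c}) :
  count_mem c (tnth q i) = count_mem (val i, val c) (indexed 0 s).
Proof.
rewrite count_display -Ds indexed_omap count_map.
by apply: eq_count => -[k d]; rewrite /= !xpair_eqE.
Qed.

(** All letters of [s] come from the subtype. Hence a letter removed by H1 or H2 occurs only in the
    displayed blocks. *)
Lemma count_removed (k : nat) (a : A) :
  ~~ P a -> count_mem (k, a) (indexed 0 s) = 0.
Proof.
move=> nPa; rewrite -Ds indexed_omap; apply/count_memPn.
by apply/mapP=> -[[l [d Pd]] _ /= [_ Da]]; rewrite Da Pd in nPa.
Qed.

End RemovedLetters.

(** The sum is kept in [nat]: off the diagonal every move but H2 preserves it exactly, and reduction
    modulo 2 enters only for H2. *)
Definition linking_number (n : nat) (A : finType) (p : gauss_phrase n A)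
    (i j : 'I_n) : nat :=
  \sum_(a : A) count_mem a (tnth p i) * count_mem a (tnth p j).

Lemma count_components_le2 (n : nat) (A : finType) (p : gauss_phrase n A)
    (i j : 'I_n) (a : A) :
  i != j -> count_mem a (tnth p i) + count_mem a (tnth p j) <= 2.
Proof.
case: p => t /= /(_ a) <- ne_ij.
rewrite count_flatten sumnE big_map big_tuple (bigD1 i) //=.
by rewrite (bigD1 j) 1?eq_sym //= addnA leq_addr.
Qed.

Lemma linking_matrixE (n : nat) (A : finType) (p : gauss_phrase n A)
    (i j : 'I_n) :
  linking_matrix p i j =
    (if i == j then 0 else (linking_number p i j)%:R)%R.
Proof.
rewrite mxE; case: eqP => // /eqP ne_ij; congr (_ %:R)%R.
rewrite -sum1dep_card big_mkcond; apply: eq_bigr => a _ /=.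
have := count_components_le2 p a ne_ij.
(* When the counts sum to at most 2, their product is nonzero only if both are 1, and then it is
   1. *)
by move: (count_mem a _) (count_mem a _) => [|[|[|u]]] [|[|[|v]]].
Qed.

Lemma eq_linking_number (n : nat) (A : finType) (p q : gauss_phrase n A) :
  (forall i a, count_mem a (tnth p i) = count_mem a (tnth q i)) ->
  linking_number p =2 linking_number q.
Proof. by move=> eq_pq i j; apply: eq_bigr => a _; rewrite !eq_pq. Qed.

Lemma linking_number_iso (n : nat) (A1 A2 : finType) (p : gauss_phrase n A1)
    (q : gauss_phrase n A2) :
  isomorphism p q -> linking_number p =2 linking_number q.
Proof.
case=> f bij_f Dq i j; rewrite [RHS](reindex f) /=; last exact: onW_bij.
apply: eq_bigr => a _; rewrite !Dq !count_map.
by congr (_ * _); apply: eq_count => b /=; rewrite (bij_eq bij_f).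
Qed.

Lemma linking_number_shift (n : nat) (A : finType) (p q : gauss_phrase n A) :
  shift_move p q -> linking_number p =2 linking_number q.
Proof.
case=> k [a [y [Dp Dq]]]; apply: eq_linking_number => i b; rewrite Dq.
by case: eqP => // ->; rewrite Dp -cats1 count_cat /= addn0 addnC.
Qed.

Lemma linking_number_H3 (n : nat) (A : finType) (p q : gauss_phrase n A) :
  H3_move p q -> linking_number p =2 linking_number q.
Proof.
case=> a [b [c [_ [w [x [y [z [Dp Dq]]]]]]]]; apply: eq_linking_number => i d.
(* A two-letter block has no separator, so both displays index [w], [x], [y], [z] alike; only the
   two summands within each block are exchanged. *)
rewrite !count_display Dp Dq !indexed_cat !count_cat /separators /= !addn0.
by congr (_ + (_ + (_ + (_ + (_ + (_ + _)))))); apply: addnC.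
Qed.

Lemma sum_kept (A : finType) (P : pred A) (F : A -> nat) :
  \sum_(c : {c : A | P c}) F (val c) = \sum_(c | P c) F c.
Proof. by rewrite -big_sub. Qed.

Lemma linking_number_H1 (n : nat) (A : finType) (a : A) (p : gauss_phrase n A)
    (q : gauss_phrase n (without1 a)) (i j : 'I_n) :
  i != j -> H1_move p q -> linking_number p i j = linking_number q i j.
Proof.
move=> ne_ij [x [y [Dp Dq]]].
(* [separators x] is the index of the component containing both copies of [a]. *)
have count_p k c : count_mem c (tnth p k) =
    count_mem (val k, c) (indexed 0 (x ++ y)) +
    ((separators x, a) == (val k, c)).*2.
  rewrite count_display Dp !indexed_cat !count_cat /separators /= !addn0 add0n.
  by rewrite -addnn [in RHS]addnAC -!addnA.
rewrite /linking_number (bigD1 a) //= -sum_kept.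
rewrite !count_p !(count_removed Dq) ?eqxx // !xpair_eqE !eqxx !andbT.
(* As [i] and [j] differ, at most one of them is the component of [a], so a factor vanishes. *)
rewrite [X in X + _](_ : _ = 0) ?add0n; last first.
  case: (eqVneq (separators x)) => // ->.
  by rewrite (inj_eq val_inj) (negbTE ne_ij) muln0.
apply: eq_bigr => c _; rewrite !(count_kept Dq) !count_p !xpair_eqE.
by rewrite (eq_sym a) (negbTE (valP c)) !andbF !addn0.
Qed.

Lemma linking_number_H2 (n : nat) (A : finType) (a b : A)
    (p : gauss_phrase n A) (q : gauss_phrase n (without2 a b)) (i j : 'I_n) :
  H2_move p q ->
  linking_number p i j =
    (count_mem a (tnth p i) * count_mem a (tnth p j)).*2 + linking_number q i j.
Proof.
move=> [ne_ab [x [y [z [Dp Dq]]]]].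
(* How many of the two displayed blocks lie in component [k]; each block contains [a] and [b]
   once. *)
pose multiplicity k := (separators x == k) + (separators x + separators y == k).
have count_p k c : count_mem c (tnth p k) =
    count_mem (val k, c) (indexed 0 (x ++ y ++ z)) +
    multiplicity (val k) * ((a == c) + (b == c)).
  rewrite count_display Dp !indexed_cat !count_cat /separators /= !addn0 !add0n.
  rewrite !xpair_eqE /multiplicity /separators.
  by do 4!case: (_ == _); rewrite /= !(addn0, add0n, addnS, addSn).
(* Neither letter occurs in [x ++ y ++ z], so both counts equal the multiplicity. *)
have count_b k : count_mem b (tnth p k) = count_mem a (tnth p k).
  rewrite !count_p !(count_removed Dq) ?eqxx ?andbF //.
  by rewrite (eq_sym b) (negbTE ne_ab).
rewrite /linking_number (bigD1 a) //= (bigD1 b) 1?eq_sym //= !count_b addnA addnn.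
rewrite -sum_kept; congr (_ + _); apply: eq_bigr => c _.
rewrite !(count_kept Dq) !count_p (eq_sym a) (eq_sym b).
by have /andP[/negbTE-> /negbTE->] := valP c; rewrite !muln0 !addn0.
Qed.

Lemma linking_matrix_move (n : nat) (A1 A2 : finType) (p : gauss_phrase n A1)
    (q : gauss_phrase n A2) :
  move p q -> linking_matrix p = linking_matrix q.
Proof.
move=> mv; apply/matrixP=> i j; rewrite !linking_matrixE; case: eqP => // /eqP.
case: mv i j => {A1 A2 p q} [A1 A2|A|A a|A a b|A] p q mv i j ne_ij.
- by rewrite (linking_number_iso mv).
- by rewrite (linking_number_shift mv).
- by rewrite (linking_number_H1 ne_ij mv).
(* The doubled term vanishes in characteristic 2. *)
- rewrite (linking_number_H2 i j mv) -muln2 natrD natrM.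
  by rewrite (_ : 2%:R = 0 :> 'F_2)%R ?mulr0 ?add0r //; apply/eqP.
- by rewrite (linking_number_H3 mv).
Qed.

Theorem theorem3p4 (n : nat) (A1 A2 : finType)
    (p : gauss_phrase n A1) (q : gauss_phrase n A2) :
  homotopic p q -> linking_matrix p = linking_matrix q.
Proof.
elim=> {A1 A2 p q} // A1 A2 A3 p q r _ -> /linking_matrix_move //.
Qed.
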